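(* Let $n\ge 1$, let $q_1,\ldots,q_n\ge 2$ be integers, let $V=[q_1]\times\cdots\times[q_n]$, and let $t$ be an integer with $0\le t\le n$. A nonempty (finite) multiset $C$ of elements of $V$ is an orthogonal array $\mathrm{OA}(|C|,q_1\cdot q_2\cdot\ldots\cdot q_n,t)$ if and only if $C$ is an algebraic $t$-design in the multigraph $H(q_1\cdot q_2\cdot\ldots\cdot q_n)$.
   Context: For a positive integer $s$, $[s]=\{0,\ldots,s-1\}$. Graphs are multigraphs; the adjacency matrix $A$ of a graph with vertex set $V$ has $A_{x,y}$ equal to the multiplicity of the edge $\{x,y\}$. Eigenfunctions of the graph are eigenvectors of $A$ viewed as functions $V\to\mathbb{C}$; the eigenspace of an eigenvalue $\theta$ is the set of all $f:V\to\mathbb C$ with $Af=\theta f$. The graph $H(q_1\cdot\ldots\cdot q_n)$ has vertex set $V=[q_1]\times\cdots\times[q_n]$; two $n$-tuples are joined by an edge of multiplicity $Q/q_i$ if they differ in exactly one position, namely the $i$th, where $Q=\mathrm{lcm}(q_1,\ldots,q_n)$; all other pairs are non-adjacent. Its distinct eigenvalues are $\theta_w=k-wQ$, $w=0,\ldots,n$, where $k=\sum_{i=1}^n\frac{Q}{q_i}(q_i-1)$ is its degree. Algebraic $t$-design: for a regular graph with distinct eigenvalues $\theta_0>\theta_1>\ldots>\theta_d$ and corresponding eigenspaces $S_0,\ldots,S_d$, a multiset $C$ of vertices is an algebraic $t$-design if in the decomposition $f_C=\varphi_0+\varphi_1+\cdots+\varphi_d$, $\varphi_i\in S_i$, of its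 multiplicity function $f_C$ one has $\varphi_1=\cdots=\varphi_t\equiv 0$. Orthogonal array: a nonempty multiset $C$ of elements of $V$ is an orthogonal array of strength $t$, denoted $\mathrm{OA}(|C|,q_1\cdot\ldots\cdot q_n,t)$, if for any distinct $i_1,\ldots,i_t\in\{1,\ldots,n\}$ and any $a_j\in[q_{i_j}]$, $j=1,\ldots,t$, the number (counted with multiplicity) of $(x_1,\ldots,x_n)\in C$ with $x_{i_j}=a_j$ for all $j=1,\ldots,t$ equals $|C|/(q_{i_1}\cdots q_{i_t})$. Cardinalities of multisets count multiplicities. *)

(* Defs.v *)
From HB Require Import structures.
From mathcomp Require Import all_boot all_order all_algebra.
From mathcomp Require Import finmap multiset.
From mathcomp Require Import complex.
From mathcomp Require Import reals.

Set Implicit Arguments.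
Unset Strict Implicit.
Unset Printing Implicit Defensive.

Import Order.TTheory GRing.Theory Num.Theory.
Local Open Scope ring_scope.
Local Open Scope mset_scope.

(* Finite multigraphs, given by their symmetric adjacency matrix:             *)
(* edge_mult G x y is the multiplicity of the edge {x, y}.                    *)
Record multigraph (V : finType) := Multigraph {
  edge_mult :> V -> V -> nat;
  edge_mult_sym : forall x y, edge_mult x y = edge_mult y x }.

Definition regular (V : finType) (G : multigraph V) (k : nat) : Prop :=
  forall x, (\sum_y G x y)%N = k.

Section AlgebraicDesign.
Variables (R : realType) (V : finType) (G : multigraph V).
Implicit Types (f : {ffun V -> R[i]}) (theta : R[i]).

Definition in_eigenspace theta f : Prop :=
  forall x, \sum_y (G x y)%:R * f y = theta * f x.

Definition graph_eigenvalue theta : Prop :=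
  exists2 f, f != 0 & in_eigenspace theta f.

(* The order on R[i] is the partial one (x < y iff y - x is a positive real), *)
(* which is total on the eigenvalues of a multigraph, as they are real.       *)
Definition distinct_eigenvalues (thetas : seq R[i]) : Prop :=
  sorted >%R thetas /\
  forall theta, theta \in thetas <-> graph_eigenvalue theta.

Definition multiplicity_function (C : {mset V}) : {ffun V -> R[i]} :=
  [ffun x => (C x)%:R].

(* Eigenvectors for distinct eigenvalues being independent, thetas and phi    *)
(* are uniquely determined by the first three conditions.                     *)
Definition algebraic_design (t : nat) (C : {mset V}) : Prop :=
  exists (thetas : seq R[i]) (phi : 'I_(size thetas) -> {ffun V -> R[i]}),
    [/\ distinct_eigenvalues thetas,
        forall i : 'I_(size thetas), in_eigenspace thetas`_i (phi i),
        multiplicity_function C = \sum_i phi i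
      & forall i : 'I_(size thetas), (1 <= i <= t)%N -> phi i = 0].

End AlgebraicDesign.

Arguments algebraic_design R {V} G t C.

Section MixedHamming.
Variables (n : nat) (q : 'I_n -> nat).

Definition mixed_words := {dffun forall i : 'I_n, 'I_(q i)}.

Definition lcm_alphabets : nat := \big[lcmn/1%N]_(i < n) q i.

Definition differ_exactly_at (x y : mixed_words) (i : 'I_n) : bool :=
  [forall j, (x j != y j) == (j == i)].

Definition hamming_mult (x y : mixed_words) : nat :=
  if [pick i | differ_exactly_at x y i] is Some i
  then lcm_alphabets %/ q i else 0%N.

Lemma hamming_mult_sym x y : hamming_mult x y = hamming_mult y x.
Proof.
rewrite /hamming_mult; congr (if _ is Some i then _ else _).
apply: eq_pick => i; apply: eq_forallb => j.
by rewrite (eq_sym (x j)).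
Qed.

Definition mixed_hamming : multigraph mixed_words :=
  Multigraph hamming_mult_sym.

Lemma hamming_multE x y :
  hamming_mult x y =
  (\sum_(i | differ_exactly_at x y i) lcm_alphabets %/ q i)%N.
Proof.
rewrite /hamming_mult; case: pickP => [i Hi|H]; last by rewrite big_pred0.
rewrite (big_pred1 i) // => j /=; apply/idP/eqP => [Hj|-> //].
have /eqP := forallP Hi j; have /eqP := forallP Hj j.
by rewrite eqxx => -> /esym/eqP.
Qed.

Lemma card_differ_exactly_at (x : mixed_words) (i : 'I_n) :
  #|[pred y | differ_exactly_at x y i]| = (q i - 1)%N.
Proof.
pose upd (a : 'I_(q i)) : mixed_words := [ffun j => dfwith x a j].
have updi a : upd a i = a by rewrite ffunE dfwith_in.
have updo a j : j != i -> upd a j = x j.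
  by move=> ji; rewrite ffunE dfwith_out // eq_sym.
have upd_inj : injective upd.
  move=> a b /(congr1 (fun y : mixed_words => y i)).
  by rewrite !updi.
have -> : (q i - 1)%N = #|[pred a : 'I_(q i) | a != x i]|.
  by have := cardC1 (x i); rewrite card_ord subn1.
rewrite -(card_image upd_inj); apply: eq_card => y; apply/idP/imageP.
  move=> /= /forallP Hy; exists (y i).
    by have /eqP := Hy i; rewrite eqxx inE eq_sym.
  apply/ffunP => j; have [->|ji] := eqVneq j i; first by rewrite updi.
  rewrite updo //; have /eqP := Hy j.
  by rewrite (negbTE ji) => /negbFE/eqP.
case=> a ax ->; apply/forallP => j; have [->|ji] := eqVneq j i.
  by move: ax; rewrite updi inE eq_sym => ->.
by rewrite updo // eqxx.
Qed.

Lemma mixed_hamming_regular :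
  regular mixed_hamming (\sum_(i < n) lcm_alphabets %/ q i * (q i - 1))%N.
Proof.
move=> x /=; under eq_bigr => y _ do rewrite hamming_multE.
rewrite (exchange_big_dep xpredT) //=; apply: eq_bigr => i _.
by rewrite sum_nat_const card_differ_exactly_at mulnC.
Qed.

(* The positions i_1, ..., i_t are given by an injection pos : 'I_t -> 'I_n.  *)
(* The quotient is taken in rat, so that strength t entails divisibility.     *)
Definition orthogonal_array (N t : nat) (C : {mset mixed_words}) : Prop :=
  [/\ C != mset0, size C = N
    & forall (pos : 'I_t -> 'I_n) (a : forall j : 'I_t, 'I_(q (pos j))),
        injective pos ->
        (count (fun x : mixed_words => [forall j, x (pos j) == a j]) C)%:R
        = N%:R / (\prod_(j < t) q (pos j))%N%:R :> rat].

End MixedHamming.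

(* Main.v *)
Require Import Defs.
From mathcomp Require Import all_boot all_order all_algebra.
From mathcomp Require Import finmap multiset.
From mathcomp Require Import complex.
From mathcomp Require Import reals.
From mathcomp Require Import ring.

(* Every operator involved is a tensor kernel, a product over the coordinates *)
(* of kernels on the alphabets.  With d the identity and u the averaging      *)
(* kernel, the P_S = (d - u)^S u^(complement of S) sum to the identity, and   *)
(* the adjacency operator is A = k - Q sum_i (d - u)_i, so that P_S projects  *)
(* into the eigenspace of k - |S| Q.  Hence f is a t-design iff P_S f = 0 for *)
(* 1 <= |S| <= t.  On the other hand, strength t says that averaging f over   *)
(* the complement of T gives a constant whenever |T| = t, and this averaging  *)
(* operator is the sum of the P_S over the subsets S of T.                    *)

Set Implicit Arguments.
Unset Strict Implicit.
Unset Printing Implicit Defensive.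

Import Order.TTheory GRing.Theory Num.Theory.

Local Open Scope mset_scope.
Local Open Scope ring_scope.

(** Product kernels compose coordinate by coordinate ([tensor_comp]), so every operator identity
    reduces to one alphabet, where [u] and [d - u] are complementary idempotents. The weights
    [Q / q i] make each direction contribute the same multiple [Q] of [d - u] to the adjacency
    matrix ([hamming_laplacian]), so the eigenvalue on the image of P_S depends on #|S| only and
    strictly decreases with it; the index of an eigenspace is thus #|S|. Both sides of the theorem
    become linear conditions on the multiplicity function: [algebraic_design_project] for designs,
    [orthogonal_array_average] for arrays. [average_project_equiv] matches the two, since P_S does
    not change under prior averaging outside a set T containing S, and kills constants when S is
    nonempty. *)

Lemma sum_dffun_prod (F : comNzRingType) (I : finType) (T : I -> finType)
    (k : forall i, T i -> F) :
  \sum_(y : {dffun forall i, T i}) \prod_i k i (y i) = \prod_i \sum_a k i a.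
Proof.
(* The bijection with [fprod T] turns the claim into distributivity over tagged letters. *)
transitivity (\sum_(g : fprod T) \prod_i [ffun a => k i a] (g i)).
  rewrite (reindex (@fprod_of_dffun _ T)); last first.
    exact/onW_bij/fprod_of_dffun_bij.
  by apply: eq_bigr => y _; apply: eq_bigr => i _; rewrite ffunE fprodE.
rewrite (big_fprod 1 +%R) -(bigA_distr_big_dep _
  (fun i => untag 0 [ffun a : T i => k i a])).
apply: eq_bigr => i _; rewrite -(big_tag (fun i => [ffun a : T i => k i a])).
by apply: eq_bigr => a _; rewrite ffunE.
Qed.

Lemma count_sum_count_mem (T : finType) (P : pred T) (s : seq T) :
  count P s = (\sum_(y | P y) count_mem y s)%N.
Proof.
elim: s => [|z s IHs] /=; first by rewrite big1.
rewrite big_split /= IHs; congr (_ + _)%N.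
under eq_bigr do rewrite eq_sym.
have [Pz|/negPf nPz] := boolP (P z).
  by rewrite (bigD1 z) //= eqxx big1 // => y /andP[_ /negPf ->].
by rewrite big1 // => y Py; case: eqP Py => // ->; rewrite nPz.
Qed.

Lemma prod_natr_bool (F : comNzRingType) (I : finType) (P Q : pred I) :
  \prod_(i | P i) (Q i)%:R = [forall (i | P i), Q i]%:R :> F.
Proof.
have [/forall_inP PQ|] := boolP [forall (i | P i), Q i].
  by rewrite big1 // => i /PQ ->.
rewrite negb_forall_in => /exists_inP [i Pi /negPf Qi].
by rewrite (bigD1 i) //= Qi mul0r.
Qed.

Lemma subset_of_card (T : finType) (S : {set T}) (t : nat) :
  (#|S| <= t <= #|T|)%N -> exists2 U : {set T}, S \subset U & #|U| = t.
Proof.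
case/andP => /subnK <-; elim: (t - #|S|)%N => [|m IHm] tT; first by exists S.
case: IHm => [|U SU cU]; first by apply: leq_trans tT; rewrite addSn.
have /set0Pn [x] : ~: U != set0.
  by rewrite -card_gt0 cardsCs setCK subn_gt0 cU; rewrite addSn in tT.
rewrite inE => xU; exists (x |: U); last by rewrite cardsU1 xU cU.
exact: subset_trans SU (subsetUr _ _).
Qed.

(** * Product kernels, harmonic projections and marginals *)

Section TensorKernels.
Variables (F : numFieldType) (n : nat) (q : 'I_n -> nat).
Hypothesis q_gt0 : forall i, (0 < q i)%N.

Local Notation V := (mixed_words q).
Local Notation kernel := (forall i, 'I_(q i) -> 'I_(q i) -> F).
Implicit Types (S T : {set 'I_n}) (f : {ffun V -> F}) (k l : kernel).

Definition tensor (k : kernel) (x y : V) : F := \prod_i k i (x i) (y i).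

Lemma eq_tensor (k l : kernel) : (forall i a b, k i a b = l i a b) ->
  forall x y, tensor k x y = tensor l x y.
Proof. by move=> kl x y; apply: eq_bigr => i _. Qed.

Lemma tensor0 (k : kernel) j : (forall a b, k j a b = 0) ->
  forall x y, tensor k x y = 0.
Proof. by move=> k0 x y; rewrite /tensor (bigD1 j) //= k0 mul0r. Qed.

Definition comp_kernel (k l : kernel) : kernel :=
  fun i a c => \sum_b k i a b * l i b c.
Arguments comp_kernel k l i a c : clear implicits.

Lemma tensor_comp (k l : kernel) (x z : V) :
  \sum_y tensor k x y * tensor l y z = tensor (comp_kernel k l) x z.
Proof.
apply: etrans (sum_dffun_prod (fun i b => k i (x i) b * l i b (z i))).
by apply: eq_bigr => y _; rewrite big_split.
Qed.

Definition id_kernel : kernel := fun i a b => (a == b)%:R.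
Definition avg_kernel : kernel := fun i _ _ => (q i)%:R^-1.
Arguments id_kernel i a b : clear implicits.
Arguments avg_kernel i a b : clear implicits.

Lemma sum_id_kernelr i (h : 'I_(q i) -> F) c :
  \sum_b h b * id_kernel i b c = h c.
Proof.
rewrite (bigD1 c) //= /id_kernel eqxx mulr1 big1 ?addr0 // => b /negPf ->.
by rewrite mulr0.
Qed.

Lemma natr_alphabet_neq0 i : (q i)%:R != 0 :> F.
Proof. by rewrite pnatr_eq0 -lt0n. Qed.

Lemma sum_avg_kernel i a : \sum_b avg_kernel i a b = 1.
Proof.
rewrite /avg_kernel sumr_const card_ord -[LHS]mulr_natr.
by rewrite mulVf ?natr_alphabet_neq0.
Qed.

Lemma sum_id_kernel i a : \sum_b id_kernel i a b = 1.
Proof.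
under eq_bigr do rewrite /id_kernel eq_sym -[(_ == _)%:R]mul1r.
exact: (@sum_id_kernelr i (fun=> 1)).
Qed.

Lemma tensor_id (x y : V) : tensor id_kernel x y = (x == y)%:R.
Proof.
rewrite /tensor /id_kernel prod_natr_bool; congr (nat_of_bool _)%:R.
apply/forallP/eqP => [xy|-> i]; last exact/implyP.
by apply/ffunP => i; apply/eqP; apply: (implyP (xy i)).
Qed.

(* [harmonic S] projects onto the functions that depend on the coordinates in *)
(* [S] only and have zero mean along each of them; [marginal T] averages over *)
(* the coordinates outside [T].                                               *)
Definition harmonic (S : {set 'I_n}) : kernel := fun i a b =>
  if i \in S then id_kernel i a b - avg_kernel i a b else avg_kernel i a b.
Definition marginal (T : {set 'I_n}) : kernel := fun i a b =>
  if i \in T then id_kernel i a b else avg_kernel i a b.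
Arguments harmonic S i a b : clear implicits.
Arguments marginal T i a b : clear implicits.

Lemma harmonic_sym S (x y : V) :
  tensor (harmonic S) x y = tensor (harmonic S) y x.
Proof.
by apply: eq_bigr => i _; rewrite /harmonic /id_kernel eq_sym.
Qed.

Lemma harmonic_set0 (x y : V) :
  tensor (harmonic set0) x y = tensor (marginal set0) x y.
Proof. by apply: eq_tensor => i a b; rewrite /harmonic /marginal inE. Qed.

(** The diagonal factors are [1 - 1 / q i] and [1 / q i]. Hence no P_S vanishes, and each expected
    eigenvalue does occur. *)
Lemma harmonic_diag_neq0 S (x : V) : (forall i, 1 < q i)%N ->
  tensor (harmonic S) x x != 0.
Proof.
move=> q_gt1; apply/prodf_neq0 => i _; rewrite /harmonic /id_kernel /avg_kernel.
case: ifP => _; last by rewrite invr_eq0 natr_alphabet_neq0.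
rewrite eqxx /= subr_eq0 eq_sym invr_eq1 -[1]/(1%:R) eqr_nat.
by rewrite gtn_eqF.
Qed.

Lemma marginal_sum_harmonic T (x y : V) :
  tensor (marginal T) x y =
  \sum_(S : {set 'I_n} | S \subset T) tensor (harmonic S) x y.
Proof.
pose G i := id_kernel i (x i) (y i) - avg_kernel i (x i) (y i).
(* The factor [(i \in T)%:R] lets the product expand over all S; a term with S not inside T has a
   zero factor. *)
transitivity (\prod_i ((i \in T)%:R * G i + avg_kernel i (x i) (y i))).
  apply: eq_bigr => i _; rewrite /marginal /G.
  by case: ifP => _; rewrite ?mul0r ?add0r // mul1r subrK.
rewrite bigA_distr /= [RHS]big_mkcond; apply: eq_bigr => S _.
case: ifP => [/subsetP ST|/negP/negP/subsetPn [i iS /negPf iT]].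
  apply: eq_bigr => i _; rewrite /harmonic; case: ifP => // iS.
  by rewrite ST // mul1r.
by rewrite (bigD1 i) //= iS iT !mul0r.
Qed.

(** On T the marginal kernel is the identity; off T both kernels are [u], and [u] is idempotent. *)
Lemma comp_harmonic_marginal (S T : {set 'I_n}) : S \subset T ->
  forall i a b, comp_kernel (harmonic S) (marginal T) i a b = harmonic S i a b.
Proof.
move=> /subsetP ST i a c; rewrite /comp_kernel /marginal.
have [iT|iT] := boolP (i \in T); first exact: sum_id_kernelr.
have iS : (i \in S) = false by apply: contraNF iT => /ST.
by rewrite /harmonic iS -mulr_suml sum_avg_kernel mul1r.
Qed.

Lemma comp_harmonic_mean (S : {set 'I_n}) i : i \in S ->
  forall a b, comp_kernel (harmonic S) (marginal set0) i a b = 0.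
Proof.
move=> iS a c; rewrite /comp_kernel /marginal /harmonic inE iS -mulr_suml.
by rewrite sumrB sum_id_kernel sum_avg_kernel subrr mul0r.
Qed.

(** * The adjacency operator and its eigenvalues *)

Definition laplacian (j : 'I_n) : kernel := fun i a b =>
  if i == j then id_kernel i a b - avg_kernel i a b else id_kernel i a b.
Arguments laplacian j i a b : clear implicits.

(** [d - u] is idempotent and annihilates [u], so the Laplacian of coordinate j acts as 1 or 0
    according to whether j is in S. *)
Lemma comp_harmonic_laplacian (S : {set 'I_n}) j (x z : V) :
  tensor (comp_kernel (harmonic S) (laplacian j)) x z =
  (j \in S)%:R * tensor (harmonic S) x z.
Proof.
have compB i a c :
    \sum_b harmonic S i a b * (id_kernel i b c - avg_kernel i b c) = (i \in S)%:R * harmonic S i a c.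
  under eq_bigr do rewrite mulrBr.
  rewrite sumrB sum_id_kernelr -mulr_suml /harmonic; case: ifP => _.
    by rewrite sumrB sum_id_kernel sum_avg_kernel subrr mul0r subr0 mul1r.
  by rewrite sum_avg_kernel mul1r subrr mul0r.
rewrite /tensor (bigD1 j) //= [in RHS](bigD1 j) //= mulrA; congr (_ * _).
  by rewrite /comp_kernel /laplacian eqxx compB.
apply: eq_bigr => i /negPf ij; rewrite /comp_kernel /laplacian ij.
exact: sum_id_kernelr.
Qed.

Local Notation Q := (lcm_alphabets q).

Lemma lcm_alphabets_gt0 : (0 < Q)%N.
Proof.
rewrite /lcm_alphabets; elim/big_ind: _ => // a b a0 b0.
by rewrite lcmn_gt0 a0.
Qed.

Lemma natr_lcm_div i : (Q %/ q i)%:R = Q%:R / (q i)%:R :> F.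
Proof.
have /dvdnP [m ->] : (q i %| Q)%N.
  by rewrite /lcm_alphabets (bigD1 i) // dvdn_lcml.
by rewrite mulnK // natrM mulfK // natr_alphabet_neq0.
Qed.

Definition hamming_degree : F := \sum_i (Q%:R - Q%:R / (q i)%:R).

(** In direction i the adjacency kernel is Q/q_i times (J - d) with J = q_i u, which equals (Q -
    Q/q_i) d - Q (d - u). *)
Lemma hamming_laplacian (x y : V) :
  (hamming_mult x y)%:R = hamming_degree * (x == y)%:R
    - Q%:R * \sum_i tensor (laplacian i) x y.
Proof.
rewrite hamming_multE natr_sum big_mkcond /= mulr_suml mulr_sumr -sumrB.
apply: eq_bigr => i _; rewrite natr_lcm_div.
rewrite /tensor (bigD1 i) //= /laplacian eqxx.
rewrite (eq_bigr (fun j => (x j == y j)%:R)); last first.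
  by move=> j /negPf ->.
rewrite prod_natr_bool /id_kernel /avg_kernel.
have [/forall_inP agree|] := boolP [forall (j | j != i), x j == y j].
  have -> : differ_exactly_at x y i = (x i != y i).
    apply/forallP/idP => [/(_ i)|xyi j]; first by rewrite eqxx => /eqP.
    have [->|/agree /eqP ->] := eqVneq j i; first by rewrite xyi.
    by rewrite eqxx.
  have -> : (x == y) = (x i == y i).
    apply/eqP/eqP => [-> //|xyi]; apply/ffunP => j.
    by have [->|/agree /eqP] := eqVneq j i.
  by case: eqP => _ /=; ring.
rewrite negb_forall_in => /exists_inP [j ji xyj].
have -> : differ_exactly_at x y i = false.
  by apply/negP => /forallP /(_ j); rewrite xyj (negPf ji).
have -> : (x == y) = false by apply: contraNF xyj => /eqP ->.
by rewrite !mulr0 subr0.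
Qed.

Definition hamming_eigenvalue (w : nat) : F := hamming_degree - Q%:R *+ w.

Lemma harmonic_adjacency (S : {set 'I_n}) (x z : V) :
  \sum_y tensor (harmonic S) x y * (hamming_mult y z)%:R =
  hamming_eigenvalue #|S| * tensor (harmonic S) x z.
Proof.
under eq_bigr do rewrite hamming_laplacian mulrBr.
rewrite sumrB.
have -> : \sum_y tensor (harmonic S) x y * (hamming_degree * (y == z)%:R) =
    hamming_degree * tensor (harmonic S) x z.
  rewrite (bigD1 z) //= eqxx mulr1 big1 ?addr0; first by rewrite mulrC.
  by move=> y /negPf ->; rewrite !mulr0.
have -> : \sum_y tensor (harmonic S) x y *
      (Q%:R * \sum_i tensor (laplacian i) y z) =
    Q%:R *+ #|S| * tensor (harmonic S) x z.
  under eq_bigr do rewrite mulrCA mulr_sumr.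
  rewrite -mulr_sumr exchange_big /=.
  under eq_bigr do rewrite tensor_comp comp_harmonic_laplacian.
  have -> : \sum_i (i \in S)%:R * tensor (harmonic S) x z =
      #|S|%:R * tensor (harmonic S) x z.
    by rewrite -mulr_suml -natr_sum -sum1_card [in RHS]big_mkcond.
  by rewrite mulrA mulr_natr.
by rewrite mulrBl.
Qed.

(** * Projections and averages acting on functions *)

Definition project (S : {set 'I_n}) (f : {ffun V -> F}) : {ffun V -> F} :=
  [ffun x => \sum_y tensor (harmonic S) x y * f y].
Definition average (T : {set 'I_n}) (f : {ffun V -> F}) : {ffun V -> F} :=
  [ffun x => \sum_y tensor (marginal T) x y * f y].

Lemma project_sum S (I : finType) (phi : I -> {ffun V -> F}) :
  project S (\sum_i phi i) = \sum_i project S (phi i).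
Proof.
apply/ffunP => x; rewrite ffunE sum_ffunE.
under [RHS]eq_bigr do rewrite ffunE.
rewrite exchange_big; apply: eq_bigr => y _.
by rewrite sum_ffunE mulr_sumr.
Qed.

Lemma project0 S : project S 0 = 0.
Proof.
apply/ffunP => x; rewrite !ffunE big1 // => y _.
by rewrite ffunE mulr0.
Qed.

Lemma average_sum_project T f :
  average T f = \sum_(S : {set 'I_n} | S \subset T) project S f.
Proof.
apply/ffunP => x; rewrite ffunE sum_ffunE.
under [RHS]eq_bigr do rewrite ffunE.
rewrite exchange_big; apply: eq_bigr => y _.
by rewrite marginal_sum_harmonic mulr_suml.
Qed.

Lemma averageT f : average setT f = f.
Proof.
apply/ffunP => x; rewrite ffunE.
have idT y : tensor (marginal setT) x y = (x == y)%:R.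
  by rewrite -tensor_id; apply: eq_tensor => i a b; rewrite /marginal inE.
under eq_bigr do rewrite idT.
rewrite (bigD1 x) //= eqxx mul1r big1 ?addr0 // => y.
by rewrite eq_sym => /negPf ->; rewrite mul0r.
Qed.

Lemma sum_project f : \sum_S project S f = f.
Proof.
rewrite -[RHS]averageT average_sum_project.
by apply: eq_bigl => S; rewrite subsetT.
Qed.

Lemma project_average S T f : S \subset T ->
  project S (average T f) = project S f.
Proof.
move=> ST; apply/ffunP => x; rewrite !ffunE.
under eq_bigr do rewrite ffunE mulr_sumr.
rewrite exchange_big; apply: eq_bigr => z _ /=.
under eq_bigr do rewrite mulrA.
rewrite -mulr_suml tensor_comp; congr (_ * _).
exact/eq_tensor/comp_harmonic_marginal.
Qed.

Lemma project_mean S f : S != set0 -> project S (average set0 f) = 0.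
Proof.
case/set0Pn => i iS; apply/ffunP => x; rewrite !ffunE.
under eq_bigr do rewrite ffunE mulr_sumr.
rewrite exchange_big big1 // => z _ /=.
under eq_bigr do rewrite mulrA.
rewrite -mulr_suml tensor_comp (tensor0 (j := i)) ?mul0r //.
exact: comp_harmonic_mean.
Qed.

Lemma project_set0 f : project set0 f = average set0 f.
Proof.
apply/ffunP => x; rewrite !ffunE.
by apply: eq_bigr => y _; rewrite harmonic_set0.
Qed.

Lemma adjacency_project S f x :
  \sum_y (hamming_mult x y)%:R * project S f y =
  hamming_eigenvalue #|S| * project S f x.
Proof.
rewrite [in RHS]ffunE mulr_sumr.
under eq_bigr do rewrite ffunE mulr_sumr.
rewrite exchange_big; apply: eq_bigr => z _ /=.
rewrite mulrA harmonic_sym -harmonic_adjacency mulr_suml; apply: eq_bigr => y _.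
by rewrite harmonic_sym hamming_mult_sym mulrA [X in X * _]mulrC.
Qed.

(** Applying P_S to A f = theta f, and using that P_S A is the #|S|-th eigenvalue times P_S, gives
    P_S f two different multipliers. *)
Lemma project_eigenfunction S f theta :
  (forall x, \sum_y (hamming_mult x y)%:R * f y = theta * f x) ->
  theta != hamming_eigenvalue #|S| -> project S f = 0.
Proof.
rewrite -subr_eq0 => Af neq; apply/ffunP => x; apply: (mulfI neq).
apply/eqP; rewrite [X in _ == _ * X]ffunE mulr0 mulrBl subr_eq0.
rewrite !ffunE !mulr_sumr; apply/eqP.
transitivity (\sum_y tensor (harmonic S) x y *
    \sum_z (hamming_mult y z)%:R * f z).
  by apply: eq_bigr => y _; rewrite Af; ring.
under eq_bigr do rewrite mulr_sumr.
rewrite exchange_big; apply: eq_bigr => z _ /=.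
by rewrite mulrA -harmonic_adjacency mulr_suml; apply: eq_bigr => y _; ring.
Qed.

Lemma average_project_equiv t f : (t <= n)%N ->
  (forall T : {set 'I_n}, #|T| = t -> average T f = average set0 f) <->
  (forall S : {set 'I_n}, (1 <= #|S| <= t)%N -> project S f = 0).
Proof.
move=> tn; split=> [avg S /andP[S0 St]|proj T Tt].
  (* A set T of size t containing S exists because t is at most n; then P_S f = P_S ([average T f])
     = P_S ([average set0 f]) = 0. *)
  case: (@subset_of_card _ S t) => [|T ST Tt]; first by rewrite St card_ord.
  by rewrite -(project_average f ST) avg // project_mean // -card_gt0.
rewrite average_sum_project (bigD1 set0) ?sub0set //= project_set0.
rewrite big1 ?addr0 // => S /andP[/subset_leq_card ST S0].
by apply: proj; rewrite card_gt0 S0 -Tt.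
Qed.

Lemma hamming_eigenvalue_lt v w :
  (hamming_eigenvalue v < hamming_eigenvalue w) = (w < v)%N.
Proof.
rewrite /hamming_eigenvalue ltrD2l ltrN2.
by rewrite ltr_pMn2l // ltr0n lcm_alphabets_gt0.
Qed.

Lemma hamming_eigenvalue_inj : injective hamming_eigenvalue.
Proof.
move=> v w vw.
have := hamming_eigenvalue_lt v w; have := hamming_eigenvalue_lt w v.
by rewrite vw ltxx; case: ltngtP.
Qed.

(** * Strength as constancy of marginals *)

Lemma marginal_indicator T (x y : V) :
  tensor (marginal T) x y =
  (\prod_(i | i \notin T) (q i)%:R^-1) * [forall (i | i \in T), y i == x i]%:R.
Proof.
rewrite /tensor (bigID (mem T)) /= mulrC; congr (_ * _).
  by apply: eq_bigr => i /negPf iT; rewrite /marginal iT.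
rewrite -prod_natr_bool; apply: eq_bigr => i iT.
by rewrite /marginal iT /id_kernel eq_sym.
Qed.

Definition mset_fun (C : {mset V}) : {ffun V -> F} := [ffun x => (C x)%:R].

Lemma average_mset T (C : {mset V}) x :
  average T (mset_fun C) x = (\prod_(i | i \notin T) (q i)%:R^-1) *
    (count (fun y : V => [forall (i | i \in T), y i == x i]) C)%:R.
Proof.
rewrite ffunE count_sum_count_mem natr_sum mulr_sumr [RHS]big_mkcond.
apply: eq_bigr => y _; rewrite ffunE marginal_indicator count_mem_mset.
by case: ifP => _; rewrite ?mulr1 // mulr0 mul0r.
Qed.

(** The factors 1/q_i with i outside T cancel; clearing the others leaves an equation between
    naturals. *)
Lemma average_mset_mean T (C : {mset V}) x :
  (average T (mset_fun C) x == average set0 (mset_fun C) x) =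
  (count (fun y : V => [forall (i | i \in T), y i == x i]) C
     * \prod_(i in T) q i == size C)%N.
Proof.
rewrite !average_mset.
have -> : count (fun y : V => [forall (i | i \in set0), y i == x i]) C = size C.
  rewrite -count_predT; apply: eq_count => y.
  by apply/forall_inP => i; rewrite inE.
rewrite [X in _ == X * _](bigID (mem T)) /=.
rewrite [X in _ == X * _ * _](eq_bigl (fun i => i \in T)); last first.
  by move=> i; rewrite !inE.
rewrite [X in _ == _ * X * _](eq_bigl (fun i => i \notin T)); last first.
  by move=> i; rewrite !inE.
rewrite [X in _ == X * _ * _]prodfV -natr_prod [X in _ == X * _]mulrC.
rewrite -mulrA [X in _ == _ * X]mulrC.
have A0 : \prod_(i | i \notin T) (q i)%:R^-1 != 0 :> F.
  by apply/prodf_neq0 => i _; rewrite invr_eq0 natr_alphabet_neq0.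
have B0 : (\prod_(i in T) q i)%:R != 0 :> F.
  by rewrite natr_prod; apply/prodf_neq0 => i _; apply: natr_alphabet_neq0.
by rewrite (inj_eq (mulfI A0)) -(inj_eq (mulIf B0)) divfK // -natrM eqr_nat.
Qed.

Lemma word_prescribed t (pos : 'I_t -> 'I_n) (a : forall j, 'I_(q (pos j))) :
  injective pos -> exists x : V, forall j, x (pos j) = a j.
Proof.
move=> pos_inj.
(* Letters are compared in nat, which avoids a cast along pos j = i. *)
exists [ffun i => odflt (Ordinal (q_gt0 i))
  [pick b : 'I_(q i) | [exists j, (pos j == i) && (a j == b :> nat)]]].
move=> j; rewrite ffunE; case: pickP => [b /existsP|/(_ (a j))] /=.
  case=> j' /andP[/eqP /pos_inj -> /eqP ab].
  exact/esym/val_inj.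
by move/negbT/existsPn/(_ j); rewrite !eqxx.
Qed.

(** An array prescribes letters along an injection, an average is evaluated at a word. Enumerating T
    gives the injection; conversely T is the image of [pos], and [word_prescribed] extends the
    letters to a word. *)
Lemma orthogonal_array_average t (C : {mset V}) : C != mset0 ->
  orthogonal_array (size C) t C <->
  (forall T, #|T| = t -> average T (mset_fun C) = average set0 (mset_fun C)).
Proof.
move=> C0.
have natP (c N m : nat) : (0 < m)%N ->
    (c%:R = N%:R / m%:R :> rat) <-> (c * m == N)%N.
  move=> m0; have m0' : m%:R != 0 :> rat by rewrite pnatr_eq0 -lt0n.
  rewrite -(eqr_nat rat) natrM; split=> [->|/eqP <-]; first by rewrite divfK.
  by rewrite mulfK.
split=> [[_ _ oa] T Tt|avg].
  apply/ffunP => x; apply/eqP; rewrite average_mset_mean; subst t.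
  have := oa _ (fun j => x (enum_val j)) (@enum_val_inj _ _).
  rewrite -(big_enum_val q) natP ?prodn_gt0 //.
  congr (_ * _ == _)%N; apply: eq_count => y.
  apply/forallP/forall_inP => [yx i iT|yx j]; last exact/yx/enum_valP.
  by have := yx (enum_rank_in iT i); rewrite enum_rankK_in.
split=> // pos a pos_inj; apply/natP; first by rewrite prodn_gt0.
have [x xa] := word_prescribed a pos_inj.
have := avg (pos @: 'I_t); rewrite card_imset // card_ord => /(_ erefl).
move/ffunP/(_ x)/eqP; rewrite average_mset_mean big_imset /=; last exact: in2W.
congr (_ * _ == _)%N; apply: eq_count => y.
apply/forall_inP/forallP => [yx j|ya _ /imsetP[j _ ->]]; last by rewrite xa.
by rewrite -xa yx ?imset_f.
Qed.

End TensorKernels.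

(** * The spectrum of [mixed_hamming] and the design condition *)

Section HammingSpectrum.
Variables (R : realType) (n : nat) (q : 'I_n -> nat).
Hypothesis q_gt1 : forall i, (1 < q i)%N.

Let q_gt0 i : (0 < q i)%N. Proof. exact: ltnW. Qed.
Local Notation G := (mixed_hamming q).
Local Notation theta := (hamming_eigenvalue R[i] q).

Definition hamming_spectrum : seq R[i] := [seq theta w | w <- iota 0 n.+1].

Lemma size_hamming_spectrum : size hamming_spectrum = n.+1.
Proof. by rewrite size_map size_iota. Qed.

Lemma nth_hamming_spectrum w : (w <= n)%N -> hamming_spectrum`_w = theta w.
Proof.
by move=> wn; rewrite (nth_map 0%N) ?size_iota // nth_iota.
Qed.

Lemma hamming_distinct_eigenvalues : distinct_eigenvalues G hamming_spectrum.
Proof.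
split.
  apply: (homo_sorted (e := ltn)); last exact: iota_ltn_sorted.
  by move=> v w vw; rewrite /= hamming_eigenvalue_lt.
move=> th; split=> [/mapP[w]|[f f0 Af]].
  rewrite mem_iota ltnS => /= wn ->.
  have [|S _ Sw] := @subset_of_card 'I_n set0 w.
    by rewrite cards0 card_ord.
  pose x : mixed_words q := [ffun i => Ordinal (q_gt0 i)].
  (* The projected point mass takes at [x] the diagonal value of the kernel, which is nonzero. *)
  exists (project S [ffun y => (y == x)%:R]); last first.
    by rewrite -Sw => y; apply: adjacency_project.
  apply/eqP => /ffunP /(_ x); rewrite !ffunE (bigD1 x) //= ffunE eqxx mulr1.
  rewrite big1 => [|y /negPf yx]; last by rewrite ffunE yx mulr0.
  by rewrite addr0; apply/eqP/harmonic_diag_neq0.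
(* The projections sum to the identity, so one of them keeps [f] nonzero and forces its
   eigenvalue. *)
have [S S0] : exists S, project S f != 0.
  apply/existsP; apply: contraNT f0 => /existsPn f0.
  by rewrite -(sum_project f) big1 // => S _; apply/eqP/negPn.
apply/mapP; exists #|S|; first by
  rewrite mem_iota ltnS /= -[leqRHS]card_ord max_card.
by apply/eqP; apply: contraNT S0 => /(project_eigenfunction q_gt0 Af) ->.
Qed.

(** Needed because [algebraic_design] quantifies existentially over the list of eigenvalues. *)
Lemma distinct_eigenvalues_uniq (V : finType) (H : multigraph V)
    (s1 s2 : seq R[i]) :
  distinct_eigenvalues H s1 -> distinct_eigenvalues H s2 -> s1 = s2.
Proof.
move=> [sort1 mem1] [sort2 mem2].
apply: (irr_sorted_eq (leT := >%R)) => // [y x z|x|x].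
- by move=> xy yz; apply: lt_trans yz xy.
- exact: ltxx.
- by apply/idP/idP => [/mem1/mem2|/mem2/mem1].
Qed.

Lemma algebraic_design_project t (C : {mset mixed_words q}) : (t <= n)%N ->
  algebraic_design R G t C <->
  (forall S : {set 'I_n}, (1 <= #|S| <= t)%N ->
     project S (mset_fun R[i] C) = 0).
Proof.
move=> tn; split=> [[thetas [phi [spec eig fC phi0]]] S St|proj].
  have defs := distinct_eigenvalues_uniq spec hamming_distinct_eigenvalues.
  subst thetas.
  rewrite [mset_fun _ _]fC project_sum big1 // => i _.
  (* Only [phi] of index #|S| could survive P_S, and the design condition makes it zero. *)
  have [Si|Si] := eqVneq (i : nat) #|S|; first by rewrite phi0 ?Si // project0.
  apply: (project_eigenfunction q_gt0 (eig i)).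
  rewrite nth_hamming_spectrum; last by rewrite -ltnS -size_hamming_spectrum.
  by apply: contraNneq Si => /hamming_eigenvalue_inj ->.
(* Grouping the harmonic components by #|S| yields the eigenspace decomposition. *)
pose phi (i : 'I_(size hamming_spectrum)) :=
  \sum_(S : {set 'I_n} | #|S| == i) project S (mset_fun R[i] C).
exists hamming_spectrum, phi; split=> [|i x||i it].
- exact: hamming_distinct_eigenvalues.
- rewrite nth_hamming_spectrum; last by rewrite -ltnS -size_hamming_spectrum.
  rewrite sum_ffunE mulr_sumr.
  under eq_bigr do rewrite sum_ffunE mulr_sumr.
  rewrite exchange_big; apply: eq_bigr => S /eqP <-.
  exact: adjacency_project.
- have lt_spec S : (#|S : {set 'I_n}| < size hamming_spectrum)%N.
    by rewrite size_hamming_spectrum ltnS -[leqRHS]card_ord max_card.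
  rewrite -[LHS](sum_project (mset_fun R[i] C)).
  rewrite (partition_big (fun S => Ordinal (lt_spec S)) xpredT) //=.
- by apply: big1 => S /eqP Si; apply: proj; rewrite Si.
Qed.

End HammingSpectrum.

Theorem theorem7 (R : realType) (n : nat) (q : 'I_n -> nat) (t : nat)
    (C : {mset mixed_words q}) :
  (1 <= n)%N -> (forall i, 2 <= q i)%N -> (t <= n)%N -> C != mset0 ->
  orthogonal_array (size C) t C <-> algebraic_design R (mixed_hamming q) t C.
Proof.
move=> _ q_gt1 tn C0; have q_gt0 i : (0 < q i)%N by apply: ltnW.
rewrite (orthogonal_array_average R[i] q_gt0 t C0).
rewrite (average_project_equiv q_gt0) //.
by rewrite algebraic_design_project.
Qed.
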